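(* Let $S$ be a finite set of distinct points in $\mathbb{R}^d$ whose cardinality is even. Then there exists an open Tverberg matching for $S$; that is, there exists a perfect matching $\mathcal{M}$ of $S$ such that the open Euclidean balls with diameters $xy$, $xy\in\mathcal{M}$, have a common point.
   Context: For two distinct points $x,y\in\mathbb{R}^d$, the open ball with diameter $xy$ is the open Euclidean ball with center $\frac{x+y}{2}$ and radius $\frac{\|x-y\|}{2}$. A graph whose vertex set is a finite set of points in $\mathbb{R}^d$ is called an open Tverberg graph if the open balls with diameters induced by its edges have non-empty intersection. A perfect matching for an even set of points in $\mathbb{R}^d$ is called an open Tverberg matching if it is an open Tverberg graph. *)

(* Defs.v *)
From mathcomp Require Import all_boot all_order all_algebra finmap.
From mathcomp Require Import classical_sets reals.

Set Implicit Arguments.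
Unset Strict Implicit.
Unset Printing Implicit Defensive.

Import Order.TTheory GRing.Theory Num.Theory.
Local Open Scope ring_scope.

(* The Euclidean norm; the norm `|v| that the library puts on matrices is the
   sup norm. *)
Definition enorm (R : realType) (d : nat) (v : 'rV[R]_d) : R :=
  Num.sqrt (\sum_(i < d) v ord0 i ^+ 2).

Definition open_diam_ball (R : realType) (d : nat) (x y : 'rV[R]_d) :
    set 'rV[R]_d :=
  [set z | enorm (z - 2^-1 *: (x + y)) < enorm (x - y) / 2]%classic.

(* Finite simple graph with vertex set V; the edge xy is the two-element set
   [fset x; y]. *)
Definition is_graph (K : choiceType) (V : {fset K}) (E : {fset {fset K}}) :
    Prop :=
  forall e : {fset K}, e \in E -> (e `<=` V)%fset /\ #|` e|%fset = 2%N.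

Definition perfect_matching (K : choiceType) (V : {fset K})
    (M : {fset {fset K}}) : Prop :=
  is_graph V M /\
  forall v : K, v \in V -> exists! e : {fset K}, e \in M /\ v \in e.

(* If there is no edge, the intersection is the whole space. *)
Definition open_tverberg_graph (R : realType) (d : nat)
    (V : {fset 'rV[R]_d}) (E : {fset {fset 'rV[R]_d}}) : Prop :=
  is_graph V E /\
  (\bigcap_(p in [set p : 'rV[R]_d * 'rV[R]_d | [fset p.1; p.2]%fset \in E])
      open_diam_ball p.1 p.2 !=set0)%classic.

Definition open_tverberg_matching (R : realType) (d : nat)
    (V : {fset 'rV[R]_d}) (M : {fset {fset 'rV[R]_d}}) : Prop :=
  perfect_matching V M /\ open_tverberg_graph V M.

(* Main.v *)
Require Import Defs.
From mathcomp Require Import all_boot all_order all_algebra finmap.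
From mathcomp Require Import classical_sets reals.
From mathcomp Require Import all_fingroup ring lra.
From mathcomp Require Import topology function_spaces tvs normedtype derive.

Set Implicit Arguments.
Unset Strict Implicit.
Unset Printing Implicit Defensive.

Import Order.TTheory GRing.Theory Num.Theory numFieldNormedType.Exports.
Local Open Scope ring_scope.

(** Among the finitely many ways of pairing up the points of [S], take one that
    minimizes the sum of the inner products [dot x y] over its pairs; since
    [|x - y|^2 = |x|^2 + |y|^2 - 2 dot x y], it maximizes the sum of the squared
    lengths of its edges. This matching works.

    Let its pairs be [a_i, b_i], and put [s_i = a_i + b_i],
    [p_i = dot a_i b_i]. A point [z] is in the open ball with diameter [a_i b_i]
    iff [dot (z - a_i) (z - b_i) = |z|^2 - dot z s_i + p_i] is negative
    ([open_diam_ball_dot]), so a common solution of these quadratic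
    inequalities is needed. The minimum over [z] of their average with weights
    [l] is the concave function
      [g l = sum_i l_i p_i - |sum_i l_i s_i|^2 / 4],
    and Lagrangian duality ([common_solution]) reduces the problem to showing
    that [g] is negative on the simplex.

    For this, exchange partners between pairs [i] and [j]. There are two ways
    to do it, and neither decreases the cost:
      [p_i + p_j <= dot a_i b_j + dot b_i a_j],
      [p_i + p_j <= dot a_i a_j + dot b_i b_j]
    ([optimal_pairing]). Their sum is [2 (p_i + p_j) <= dot s_i s_j]. For
    [i = j] this holds with the excess [|a_i - b_i|^2]. Averaging over [i] and
    [j] with the weights [l_i l_j] gives
      [4 sum_i l_i p_i + sum_i l_i^2 |a_i - b_i|^2 <= |sum_i l_i s_i|^2],
    and the excess is positive because the points are distinct
    ([common_open_ball]). *)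

(** * The Euclidean inner product *)

Definition dot (R : realType) (d : nat) (u v : 'rV[R]_d) : R :=
  \sum_(k < d) u ord0 k * v ord0 k.

Section Dot.
Variables (R : realType) (d : nat).
Implicit Types u v w : 'rV[R]_d.

Lemma dotC u v : dot u v = dot v u.
Proof. by apply: eq_bigr => k _; rewrite mulrC. Qed.

Lemma dotDl u v w : dot (u + v) w = dot u w + dot v w.
Proof. by rewrite -big_split; apply: eq_bigr => k _; rewrite mxE mulrDl. Qed.

Lemma dotZl a u w : dot (a *: u) w = a * dot u w.
Proof. by rewrite mulr_sumr; apply: eq_bigr => k _; rewrite mxE mulrA. Qed.

Lemma dotNl u w : dot (- u) w = - dot u w.
Proof. by rewrite -scaleN1r dotZl mulN1r. Qed.

Lemma dotDr u v w : dot w (u + v) = dot w u + dot w v.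
Proof. by rewrite !(dotC w) dotDl. Qed.

Lemma dotZr a u w : dot w (a *: u) = a * dot w u.
Proof. by rewrite !(dotC w) dotZl. Qed.

Lemma dotNr u w : dot w (- u) = - dot w u.
Proof. by rewrite !(dotC w) dotNl. Qed.

Definition dotE := (dotDl, dotDr, dotZl, dotZr, dotNl, dotNr).

Lemma dot_suml (I : finType) (F : I -> 'rV[R]_d) w :
  dot (\sum_i F i) w = \sum_i dot (F i) w.
Proof.
rewrite exchange_big; apply: eq_bigr => k _.
by rewrite summxE mulr_suml.
Qed.

Lemma dot_sumr (I : finType) (F : I -> 'rV[R]_d) w :
  dot w (\sum_i F i) = \sum_i dot w (F i).
Proof. by rewrite dotC dot_suml; apply: eq_bigr => i _; rewrite dotC. Qed.

Lemma dot_ge0 u : 0 <= dot u u.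
Proof. by apply: sumr_ge0 => k _; rewrite -expr2 sqr_ge0. Qed.

Lemma dot_gt0 u : u != 0 -> 0 < dot u u.
Proof.
move=> u0; rewrite lt_neqAle dot_ge0 andbT eq_sym.
apply: contraNneq u0 => /psumr_eq0P u0; apply/eqP/rowP => k; rewrite mxE.
by apply/eqP; rewrite -sqrf_eq0 expr2 u0// => ? _; rewrite -expr2 sqr_ge0.
Qed.

Lemma enormE u : enorm u = Num.sqrt (dot u u).
Proof. by congr Num.sqrt; apply: eq_bigr => k _; rewrite expr2. Qed.

(** The quadratic is [dot (z - x) (z - y)]: the ball consists of the points
    that see the segment [xy] under an obtuse angle (Thales). *)
Lemma open_diam_ball_dot (x y z : 'rV[R]_d) :
  open_diam_ball x y z <-> dot z z - dot z (x + y) + dot x y < 0.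
Proof.
have half : enorm (x - y) / 2 = enorm (2^-1 *: (x - y)).
  rewrite !enormE dotZl dotZr mulrA -expr2 sqrtrM ?sqr_ge0// sqrtr_sqr.
  by rewrite gtr0_norm ?invr_gt0// mulrC.
rewrite /open_diam_ball /= half !enormE ltNge ler_sqrt ?dot_ge0// -ltNge.
rewrite !dotE (dotC y x) (dotC x z) (dotC y z).
by split => ?; lra.
Qed.

Lemma open_diam_ball_sym (x y z : 'rV[R]_d) :
  open_diam_ball x y z -> open_diam_ball y x z.
Proof.
by move=> /open_diam_ball_dot xyz; apply/open_diam_ball_dot;
  rewrite (addrC y) (dotC y).
Qed.

End Dot.

(** * Systems of quadratic inequalities *)

Lemma continuous_sumM (R : realType) (T : topologicalType) (I : finType)
    (F G : I -> T -> R) :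
  (forall i, continuous (F i)) -> (forall i, continuous (G i)) ->
  continuous (fun v => \sum_i F i v * G i v).
Proof.
move=> cF cG.
apply: (@continuous_big _ _ _ _ xpredT (@add_continuous R) T _ _) => i _ v.
by apply: cvgM; [exact: cF|exact: cG].
Qed.

(** First-order optimality: [a] is the derivative at [t = 0] of
    [t * a - t^2 * c], which the hypothesis bounds by [0] (it is divided by [t]). *)
Lemma slope_le0 (R : realType) (a c : R) :
  (forall t, 0 < t -> t <= 1 -> a <= t * c) -> a <= 0.
Proof.
move=> H; rewrite leNgt; apply/negP => a0.
have c0 : 0 < c by rewrite -[c]mul1r (lt_le_trans a0)// H.
have ac : a <= c by rewrite -[c]mul1r H.
(* at this value of [t] the hypothesis reads [a <= a / 2] *)
have := H (a / (2 * c)).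
have -> : a / (2 * c) * c = a / 2 by field; rewrite gt_eqF.
rewrite divr_gt0 ?mulr_gt0// ler_pdivrMr ?mulr_gt0// => /(_ isT).
lra.
Qed.

Section Dual.
Variables (R : realType) (d n : nat).
Variables (s : 'I_n -> 'rV[R]_d) (p : 'I_n -> R).

Local Notation comb l := (\sum_i l i *: s i).

(** The simplex is compact and the dual function is continuous. The weights are
    functions rather than row vectors, which carry the topology, because sums
    over convex combinations are easier to transform in this form. *)
Lemma simplex_max : (0 < n)%N -> exists l : 'I_n -> R,
  [/\ forall i, 0 <= l i, \sum_i l i = 1 &
   forall m : 'I_n -> R, (forall i, 0 <= m i) -> \sum_i m i = 1 ->
    \sum_i m i * p i - dot (comb m) (comb m) / 4
      <= \sum_i l i * p i - dot (comb l) (comb l) / 4].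
Proof.
move=> n0; pose i0 := Ordinal n0.
pose A := [set v : 'rV[R]_n |
  (forall i, 0 <= v ord0 i) /\ \sum_i v ord0 i = 1]%classic.
pose g (v : 'rV[R]_n) := \sum_i v ord0 i * p i
  - dot (comb (v ord0)) (comb (v ord0)) / 4.
have cA : compact A.
  apply: bounded_closed_compact.
    exists 1; split; first exact: num_real.
    move=> M M1 v /= [v0 v1]; rewrite /Num.Def.normr/= mx_normrE.
    apply: bigmax_le; first by apply: ltW; apply: lt_trans M1.
    move=> -[i j] _ /=; rewrite (ord1 i) ger0_norm//.
    rewrite (le_trans _ (ltW M1))// -v1 (bigD1 j)//= lerDl.
    exact: sumr_ge0.
  have -> : A = (\bigcap_(i in setT) [set v : 'rV[R]_n | (0 <= v ord0 i)%R]
       `&` [set v : 'rV[R]_n | \sum_i v ord0 i = 1])%classic.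
    apply/seteqP; split => v /= [v0 v1]; split=> // i; last exact: v0.
    by move=> _; exact: v0.
  apply: closedI.
    apply: closed_bigI => i _.
    by apply: preimage_closed (@closed_ge _ 0) => v _; exact: coord_continuous.
  rewrite (_ : mkset _ = [set v : 'rV[R]_n | \sum_i v ord0 i * 1 = 1]%classic).
    apply: preimage_closed (@closed_eq _ 1) => v _.
    apply: continuous_sumM => i; first exact: coord_continuous.
    exact: cst_continuous.
  by apply/boolp.funext => v /=; under [in RHS]eq_bigr do rewrite mulr1.
have cp : continuous (fun v : 'rV[R]_n => \sum_i v ord0 i * p i).
  apply: continuous_sumM => i; first exact: coord_continuous.
  exact: cst_continuous.
have cs k : continuous (fun v : 'rV[R]_n => comb (v ord0) ord0 k).
  have -> : (fun v : 'rV[R]_n => comb (v ord0) ord0 k) =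
      fun v => \sum_i v ord0 i * s i ord0 k.
    apply/boolp.funext => v; rewrite summxE.
    by apply: eq_bigr => i _; rewrite mxE.
  apply: continuous_sumM => i; first exact: coord_continuous.
  exact: cst_continuous.
have cg : continuous g.
  move=> v; apply: cvgB; [exact: nbhs_filter|exact: cp|].
  apply: cvgMr_tmp; first exact: nbhs_filter.
  by apply: continuous_sumM => k; exact: cs.
have A0 : (A !=set0)%classic.
  exists (delta_mx ord0 i0); split=> [i|]; first by rewrite mxE ler0n.
  rewrite (bigD1 i0)//= mxE !eqxx big1 ?addr0// => i ii0.
  by rewrite mxE (negbTE ii0).
have [v /set_mem [v0 v1] vmax] :=
  EVT_max_rV A0 cA (continuous_subspaceT cg).
exists (v ord0); split=> // m m0 m1.
have rowE : (\row_j m j) ord0 = m by apply/boolp.funext => i; rewrite mxE.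
have := vmax (\row_j m j); rewrite /g rowE; apply; apply/mem_set.
by rewrite /A /= rowE.
Qed.

(** Strong duality. Let [l] maximize the dual function [g] and let [z] minimize
    the average of the quadratics with weights [l]. Moving [l] towards the
    [i]-th vertex of the simplex changes [g] at the rate (value of the [i]-th
    quadratic at [z]) - [g l]. This rate cannot be positive, so that every
    quadratic is at most [g l < 0] at [z]. *)
Lemma common_solution :
  (forall l : 'I_n -> R, (forall i, 0 <= l i) -> \sum_i l i = 1 ->
    \sum_i l i * p i < dot (comb l) (comb l) / 4) ->
  exists z, forall i, dot z z - dot z (s i) + p i < 0.
Proof.
move=> neg; have [n0|n0] := posnP n.
  by exists 0 => i; have := leq_trans (ltn_ord i) (eq_leq n0).
have [l [l0 l1 lmax]] := simplex_max n0.
exists (2^-1 *: comb l) => i.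
have := neg l l0 l1; set u := comb l in lmax *; set P := \sum_i l i * p i.
move=> Pu.
suff : dot u u / 2 - dot u (s i) / 2 + p i - P <= 0.
  by rewrite !dotE => ?; lra.
apply: (@slope_le0 R _ ((dot u u - 2 * dot u (s i) + dot (s i) (s i)) / 4)).
move=> t t0 t1.
(* [m] is the point of the segment from [l] to the [i]-th vertex at time [t] *)
pose m j := (1 - t) * l j + t * (j == i)%:R.
have mE (V : lmodType R) (F : 'I_n -> V) :
    \sum_j m j *: F j = (1 - t) *: (\sum_j l j *: F j) + t *: F i.
  rewrite scaler_sumr (bigD1 i)//= [in RHS](bigD1 i)//= addrAC.
  congr (_ + _); last first.
    apply: eq_bigr => j /negbTE ji.
    by rewrite /m ji mulr0 addr0 scalerA.
  by rewrite /m eqxx mulr1 scalerDl scalerA.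
have m0 j : 0 <= m j.
  by rewrite addr_ge0// mulr_ge0// ?subr_ge0// ltW.
have m1 : \sum_j m j = 1.
  (* over the regular module the scaling is the product of [R] *)
  have := mE R^o (fun=> 1); under eq_bigr do rewrite [_ *: _]mulr1.
  move=> ->; under eq_bigr do rewrite [_ *: _]mulr1.
  by rewrite l1 ![_ *: _]mulr1 subrK.
have mp : \sum_j m j * p j = (1 - t) * P + t * p i by exact: (mE R^o p).
have := lmax m m0 m1; rewrite mp mE -/u !dotE (dotC (s i) u).
by move=> H; rewrite -(ler_pM2l t0); move: H; rewrite -/P; lra.
Qed.

End Dual.

(** * Optimal matchings *)

(** The assumption on [i != j] is the sum of the two exchange inequalities. For
    [i = j] it holds with the excess [gap i] below, and the terms
    [l i ^+ 2 * gap i] so gained make the dual function negative. *)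
Lemma common_open_ball (R : realType) (d n : nat) (a b : 'I_n -> 'rV[R]_d) :
  (forall i, a i != b i) ->
  (forall i j, i != j -> 2 * (dot (a i) (b i) + dot (a j) (b j))
    <= dot (a i + b i) (a j + b j)) ->
  exists z, forall i, open_diam_ball (a i) (b i) z.
Proof.
move=> neq swap; pose p i := dot (a i) (b i).
pose gap i := dot (a i - b i) (a i - b i).
have [|z zP] := @common_solution R d n (fun i => a i + b i) p; last first.
  by exists z => i; apply/open_diam_ball_dot; exact: zP.
move=> l l0 l1; rewrite dot_suml.
(* Averaging the lower bound for [dot s_i s_j] over [j] only; the average over
   [i] is taken at the end. *)
have lower i : 2 * l i * p i + 2 * l i * (\sum_j l j * p j)
    + l i ^+ 2 * gap i
    <= dot (l i *: (a i + b i)) (\sum_j l j *: (a j + b j)).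
  rewrite dot_sumr.
  have -> : 2 * l i * p i + 2 * l i * (\sum_j l j * p j) + l i ^+ 2 * gap i =
      \sum_j l i * l j * (2 * (p i + p j) + (j == i)%:R * gap i).
    rewrite [RHS](eq_bigr (fun j => 2 * l i * p i * l j + 2 * l i * (l j * p j)
      + (j == i)%:R * (l i * l j * gap i))) => [|j _]; last by ring.
    rewrite !big_split /= -!mulr_sumr l1 mulr1; congr (_ + _).
    rewrite (bigD1 i)//= eqxx big1 => [|j /negbTE->]; last by rewrite mul0r.
    by rewrite mul1r addr0.
  apply: ler_sum => j _; rewrite dotZl dotZr mulrA ler_wpM2l ?mulr_ge0//.
  have [->|ij] := eqVneq j i; last first.
    by rewrite mul0r addr0; apply: swap; rewrite eq_sym.
  by rewrite ?eqxx mul1r /gap /p !dotE (dotC (b i) (a i)); lra.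
have gap_gt0 i : 0 < gap i by rewrite dot_gt0// subr_eq0.
have sq_gt0 : 0 < \sum_i l i ^+ 2 * gap i.
  rewrite lt_neqAle sumr_ge0 ?andbT => [|i _]; last first.
    by rewrite mulr_ge0 ?sqr_ge0// ltW.
  rewrite eq_sym; apply/eqP => /psumr_eq0P sq0.
  have : \sum_i l i = 0.
    apply: big1 => i _; apply/eqP; rewrite -sqrf_eq0.
    have terms_ge0 j : true -> 0 <= l j ^+ 2 * gap j.
      by rewrite mulr_ge0 ?sqr_ge0// ltW.
    have /eqP := sq0 terms_ge0 i isT.
    by rewrite mulf_eq0 (gt_eqF (gap_gt0 i)) orbF.
  by rewrite l1 => /eqP; rewrite oner_eq0.
rewrite ltr_pdivlMr//.
apply: lt_le_trans (ler_sum _ (fun i _ => lower i)).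
rewrite !big_split /= -mulr_suml -mulr_sumr l1.
under [X in _ < X + _ + _]eq_bigr do rewrite -mulrA.
rewrite -mulr_sumr.
lra.
Qed.

(** Pairs are encoded as a labelling of the points by ['I_n * bool], where
    [(i, false)] and [(i, true)] label the two ends of the [i]-th pair: then the
    pairings to choose from are given by permutations of the labels, and an
    exchange of partners is the composition with a transposition. For each
    value of [c], the inequality compares a cheapest pairing with one of the
    two other ways of pairing up the ends of pairs [i] and [j]. *)
Lemma optimal_pairing (R : realType) (n : nat)
    (w : 'I_n * bool -> 'I_n * bool -> R) : (forall a b, w a b = w b a) ->
  exists q : {perm 'I_n * bool}, forall i j c, i != j ->
    w (q (i, false)) (q (i, true)) + w (q (j, false)) (q (j, true))
      <= w (q (i, false)) (q (j, c)) + w (q (i, true)) (q (j, ~~ c)).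
Proof.
move=> wC.
pose cost (q : {perm 'I_n * bool}) := \sum_i w (q (i, false)) (q (i, true)).
case: (arg_minP cost (P := xpredT) (i0 := 1%g) isT) => q _ qmin.
exists q => i j c ij; have ji : j != i by rewrite eq_sym.
have := qmin (tperm (i, true) (j, c) * q)%g isT.
rewrite /cost (bigD1 i)//= (bigD1 j)//= [X in _ <= X](bigD1 i)//=.
rewrite [X in _ <= _ + X](bigD1 j)//= !addrA.
rewrite [X in _ <= _ + X](eq_bigr
  (fun k => w (q (k, false)) (q (k, true)))); last first.
  move=> k /andP[/negbTE ki /negbTE kj].
  by rewrite !permM !tpermD// xpair_eqE 1?(eq_sym i) 1?(eq_sym j) ?ki ?kj.
(* the pairs other than [i] and [j] are unchanged, and cancel *)
rewrite lerD2r !permM tpermL.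
rewrite (@tpermD _ (i, true) (j, c) (i, false)); last 2 first.
- by rewrite xpair_eqE andbF.
- by rewrite xpair_eqE (negbTE ji).
have tp : tperm (i, true) (j, c) (j, ~~ c) = (j, ~~ c).
  by rewrite tpermD// xpair_eqE ?(negbTE ij) ?eqxx//; case: c.
case: c tp => /= tp; rewrite tpermR tp//.
by rewrite [w (q (j, false)) (q (i, true))]wC.
Qed.

Lemma perfect_matching_pairs (K : choiceType) (V : {fset K}) (n : nat)
    (x : 'I_n * bool -> K) :
  injective x -> (forall v, v \in V <-> exists a, x a = v) ->
  perfect_matching V
    [fset [fset x (i, false); x (i, true)]%fset | i in 'I_n]%fset.
Proof.
move=> x_inj xV; split=> [_ /imfsetP[i _ ->]|v /xV[[i b] <-]].
  split; last by rewrite cardfs2 (inj_eq x_inj) xpair_eqE andbF.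
  apply/fsubsetP => v /fset2P[] ->; apply/xV.
    by exists (i, false).
  by exists (i, true).
exists [fset x (i, false); x (i, true)]%fset; split.
  split; first by apply/imfsetP; exists i.
  by apply/fset2P; case: b; [right|left].
by move=> _ [/imfsetP[j _ ->] /fset2P[] /x_inj[->]].
Qed.

Lemma even_fset_pairing (K : choiceType) (V : {fset K}) :
  ~~ odd #|` V|%fset ->
  exists n, exists x : 'I_n * bool -> K,
    injective x /\ forall v, v \in V <-> exists a, x a = v.
Proof.
move=> evenV; exists #|` V|%fset./2.
have cardV : #|{: 'I_(#|` V|%fset./2) * bool}| = #|{: V}|.
  rewrite card_prod card_ord card_bool -cardfE.
  by rewrite muln2 even_halfK.
pose x (a : 'I_(#|` V|%fset./2) * bool) : V :=
  enum_val (cast_ord cardV (enum_rank a)).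
have x_inj : injective x.
  by move=> a b /enum_val_inj/cast_ord_inj/enum_rank_inj.
have [x' _ x'K] : bijective x by apply: inj_card_bij; rewrite ?cardV.
exists (val \o x); split=> [a b /val_inj/x_inj//|v].
split=> [vV|[a <-]]; last exact: valP.
by exists (x' [` vV]%fset); rewrite /= x'K.
Qed.

Theorem theorem3 (R : realType) (d : nat) (S : {fset 'rV[R]_d})
    (evenS : ~~ odd #|` S|%fset) :
  exists M : {fset {fset 'rV[R]_d}}, open_tverberg_matching S M.
Proof.
have [n [x [x_inj xS]]] := even_fset_pairing evenS.
have [q qP] := optimal_pairing (fun a b => dotC (x a) (x b)).
pose y a := x (q a).
have y_inj : injective y by move=> a b /x_inj/perm_inj.
have yS v : v \in S <-> exists a, y a = v.
  rewrite xS; split=> -[a <-]; last by exists (q a).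
  by exists ((q^-1)%g a); rewrite /y permKV.
have pm := perfect_matching_pairs y_inj yS.
exists [fset [fset y (i, false); y (i, true)]%fset | i in 'I_n]%fset.
split=> //; split; first by case: pm.
have [||z zP] := @common_open_ball R d n (fun i => y (i, false))
    (fun i => y (i, true)).
- by move=> i; rewrite (inj_eq y_inj) xpair_eqE andbF.
- move=> i j ij.
  have := qP i j true ij; have := qP i j false ij; rewrite -!/(y _) /=.
  by rewrite !dotE; lra.
(* an edge of the matching is an unordered pair, so [u] and [v] may be its ends
   in either order *)
exists z => -[u v] /= /imfsetP[i _ /= uv].
have uv_neq : u != v.
  have := cardfs2 u v; rewrite uv cardfs2 (inj_eq y_inj) xpair_eqE andbF.
  by case: (u != v).
have /fset2P : u \in [fset y (i, false); y (i, true)]%fset by rewrite -uv fset21.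
have /fset2P : v \in [fset y (i, false); y (i, true)]%fset by rewrite -uv fset22.
move: uv_neq => /[swap] -[] -> /[swap] -[] ->; rewrite ?eqxx// => _.
exact/open_diam_ball_sym/zP.
Qed.
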